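(* Let $H$ and $M$ be real Hilbert spaces, let $J\colon H\to\mathbb{R}$ be convex and Fréchet differentiable, and let $T\colon H\to M^*$ be a bounded linear operator with dual operator $T^*\colon M\to H^*$. Suppose that there is a constant $C>0$ such that $$\|T^*q\|_{H^*}\ \geq\ C\,\|q\|_M\qquad\text{for all } q\in M .$$ Consider the minimisation problem: find $u\in\operatorname{Ker}T$ such that $$J(u)=\min_{v\in\operatorname{Ker}T}J(v).$$ Then $u\in\operatorname{Ker}T$ is a solution to this minimisation problem if and only if there exists $p\in M$ such that $$T^*p=\nabla J(u).$$ Moreover, if such $p$ exists, it is unique.
   Context: For a Hilbert space $X$, $X^*$ denotes its dual space (bounded linear functionals on $X$), and $\langle u^*,u\rangle$ denotes the duality pairing between $u^*\in X^*$ and $u\in X$. $J\colon H\to\mathbb{R}$ is Fréchet differentiable if for each $u\in H$ there exists $\nabla J(u)\in H^*$ such that $J(v)=J(u)+\langle\nabla J(u),v-u\rangle+o(\|v-u\|)$ for all $v\in H$, where $o(x)$ is any function such that $o(x)/x\to 0$ as $x\to 0^+$. The dual operator $T^*\colon M\to H^*$ of $T\colon H\to M^*$ is defined by $\langle T^*q,u\rangle=\langle Tu,q\rangle$ for all $q\in M$, $u\in H$, where the first pairing is between $H^*$ and $H$ and the second between $M^*$ and $M$. *)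

(* Defs.v *)
From HB Require Import structures.
From mathcomp Require Import all_boot all_order all_algebra sesquilinear.
From mathcomp Require Import mathcomp_extra boolp classical_sets functions.
From mathcomp Require Import reals topology normedtype landau derive convex.

Set Implicit Arguments.
Unset Strict Implicit.
Unset Printing Implicit Defensive.

Import Order.TTheory GRing.Theory Num.Theory.
Import numFieldNormedType.Exports.

Local Open Scope classical_set_scope.
Local Open Scope ring_scope.

(* A real Hilbert space is a complete normed module
   whose norm comes from a positive definite symmetric bilinear form; with
   theta := idfun, {dot H for theta} is such a form. *)
HB.mixin Record CompleteNormedModule_isHilbert (R : realType) H
    & CompleteNormedModule R H := {
  inner : {dot H for @idfun R} ;
  sqr_normE : forall x : H, `|x| ^+ 2 = inner x x
}.

#[short(type="hilbertType")]
HB.structure Definition Hilbert (R : realType) :=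
  {H of CompleteNormedModule R H & CompleteNormedModule_isHilbert R H}.

Section bounded_linear.
Context {R : realType} {V W : normedModType R}.

Definition bounded_linear_pred : {pred V -> W} := fun f =>
  `[< linear f /\ exists k : R, forall x, `|f x| <= k * `|x| >].

Record bounded_linear := BoundedLinear {
  bounded_linear_fun :> V -> W ;
  bounded_linear_subproof : bounded_linear_fun \in bounded_linear_pred
}.

HB.instance Definition _ := [isSub for bounded_linear_fun].
HB.instance Definition _ := [Choice of bounded_linear by <:].

Lemma bounded_linear_predP (f : V -> W) :
  reflect (linear f /\ exists k : R, forall x, `|f x| <= k * `|x|)
          (f \in bounded_linear_pred).
Proof. exact: asboolP. Qed.

Lemma bounded_linear_pred_closed : submod_closed bounded_linear_pred.
Proof.
split=> [|a f g /bounded_linear_predP[lf [k fk]] /bounded_linear_predP[lg [l gl]]].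
  apply/bounded_linear_predP; split=> [a x y|].
    by rewrite scaler0 addr0.
  by exists 0 => x; rewrite normr0 mul0r.
apply/bounded_linear_predP; split=> [b x y|].
  change (a *: f (b *: x + y) + g (b *: x + y) =
    b *: (a *: f x + g x) + (a *: f y + g y)).
  by rewrite lf lg !scalerDr !scalerA mulrC addrACA.
exists (`|a| * k + l) => x.
change (`|a *: f x + g x| <= (`|a| * k + l) * `|x|).
rewrite (le_trans (ler_normD _ _))// mulrDl lerD// normrZ -mulrA.
by rewrite ler_wpM2l.
Qed.

HB.instance Definition _ :=
  GRing.isSubmodClosed.Build R (V -> W) bounded_linear_pred
    bounded_linear_pred_closed.
HB.instance Definition _ := [SubChoice_isSubLmodule of bounded_linear by <:].

Lemma bounded_linear_is_linear (f : bounded_linear) : linear f.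
Proof. by case: f => f /= /bounded_linear_predP[]. Qed.

HB.instance Definition _ (f : bounded_linear) :=
  GRing.isLinear.Build R V W *:%R f (bounded_linear_is_linear f).

(* Taking the supremum over the closed unit ball rather than the unit sphere
   gives 0 on the trivial space, where the sphere is empty. *)
Definition op_norm (f : bounded_linear) : R :=
  sup [set `|f x| | x in [set x : V | `|x| <= 1]].

Lemma op_norm_has_sup (f : bounded_linear) :
  has_sup [set `|f x| | x in [set x : V | `|x| <= 1]].
Proof.
split; first by exists `|f 0|, 0 => //=; rewrite normr0.
have /bounded_linear_predP[_ [k fk]] := bounded_linear_subproof f.
exists `|k| => _ [x /= x1 <-]; rewrite (le_trans (fk x))//.
by rewrite (le_trans (ler_norm _))// normrM normr_id ler_piMr.
Qed.

Lemma op_norm_ge0 (f : bounded_linear) : 0 <= op_norm f.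
Proof.
rewrite (le_trans (normr_ge0 (f 0)))//.
apply: sup_upper_bound; first exact: op_norm_has_sup.
by exists 0 => //=; rewrite normr0.
Qed.

Lemma le_op_norm (f : bounded_linear) (x : V) : `|f x| <= op_norm f * `|x|.
Proof.
have [->|x0] := eqVneq x 0; first by rewrite linear0 !normr0 mulr0.
have nx0 : 0 < `|x| by rewrite normr_gt0.
rewrite -ler_pdivrMr//.
apply: sup_upper_bound; first exact: op_norm_has_sup.
exists (`|x|^-1 *: x) => /=.
  by rewrite normrZ ger0_norm ?invr_ge0// mulVf// gt_eqF.
by rewrite linearZ/= normrZ ger0_norm ?invr_ge0// mulrC.
Qed.

Lemma op_norm_le (f : bounded_linear) (k : R) : 0 <= k ->
  (forall x, `|f x| <= k * `|x|) -> op_norm f <= k.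
Proof.
move=> k0 fk; apply: ge_sup; first by case: (op_norm_has_sup f).
by move=> _ [x /= x1 <-]; rewrite (le_trans (fk x))// ler_piMr.
Qed.

Lemma bounded_linearP (f g : bounded_linear) : f =1 g -> f = g.
Proof. by move=> fg; apply/val_inj/funext. Qed.

Lemma op_normD (f g : bounded_linear) :
  op_norm (f + g) <= op_norm f + op_norm g.
Proof.
apply: op_norm_le => [|x]; first by rewrite addr_ge0 ?op_norm_ge0.
by rewrite mulrDl (le_trans (ler_normD _ _))// lerD// le_op_norm.
Qed.

Let op_normZ_le (a : R) (f : bounded_linear) :
  op_norm (a *: f) <= `|a| * op_norm f.
Proof.
apply: op_norm_le => [|x]; first by rewrite mulr_ge0 ?op_norm_ge0.
change (`|a *: f x| <= `|a| * op_norm f * `|x|).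
by rewrite normrZ -mulrA ler_wpM2l// le_op_norm.
Qed.

Lemma op_normZ (a : R) (f : bounded_linear) :
  op_norm (a *: f) = `|a| * op_norm f.
Proof.
apply/eqP; rewrite eq_le op_normZ_le/=.
have [->|a0] := eqVneq a 0; first by rewrite normr0 mul0r op_norm_ge0.
rewrite -ler_pdivlMl ?normr_gt0// -normfV.
by rewrite -[in leLHS](scalerK a0 f) op_normZ_le.
Qed.

Lemma op_norm0_eq0 (f : bounded_linear) : op_norm f = 0 -> f = 0.
Proof.
move=> f0; apply: bounded_linearP => x; apply/eqP.
by rewrite -normr_le0 (le_trans (le_op_norm f x))// f0 mul0r.
Qed.

HB.instance Definition _ :=
  Lmodule_isNormed.Build R bounded_linear op_normD op_normZ op_norm0_eq0.

Lemma bounded_linear_norm (f : bounded_linear) :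
  `|f| = sup [set `|f x| | x in [set x : V | `|x| <= 1]].
Proof. by []. Qed.

End bounded_linear.
Arguments bounded_linear {R} V W.

(* The scalars are R^o, that is R as a normed module over itself; the duality
   pairing of f : dual V and v : V is the application f v. *)
Notation dual V := (bounded_linear V (_^o)).

Section dual_operator.
Context {R : realType} {H M : normedModType R}.
Variable T : bounded_linear H (dual M).

Lemma dual_functional_subproof (q : M) :
  (fun u => T u q) \in @bounded_linear_pred R H R^o.
Proof.
apply/bounded_linear_predP; split=> [a u v|]; first by rewrite linearP.
exists (`|T| * `|q|) => u; rewrite (le_trans (le_op_norm (T u) q))//.
by rewrite mulrAC ler_wpM2r//; exact: (le_op_norm T u).
Qed.

Definition dual_functional (q : M) : dual H :=
  BoundedLinear (dual_functional_subproof q).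

Lemma dual_operator_subproof : dual_functional \in bounded_linear_pred.
Proof.
apply/bounded_linear_predP; split=> [a p q|].
  by apply: bounded_linearP => u /=; rewrite linearP.
exists `|T| => q; apply: op_norm_le => [|u]; first by rewrite mulr_ge0.
rewrite (le_trans (le_op_norm (T u) q))// [leRHS]mulrAC ler_wpM2r//.
exact: (le_op_norm T u).
Qed.

Definition dual_operator : bounded_linear M (dual H) :=
  BoundedLinear dual_operator_subproof.

Lemma dual_operatorE (q : M) (u : H) : dual_operator q u = T u q.
Proof. by []. Qed.

End dual_operator.

(* 'd J u is only a linear map; differentiability of J at u makes it bounded,
   and the gradient is this differential regarded as an element of dual H. *)
Section gradient.
Context {R : realType} {H : normedModType R} (J : H -> R^o) (u : H).
Hypothesis dJ : differentiable J u.

Lemma gradient_subproof : ('d J u : H -> R^o) \in bounded_linear_pred.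
Proof.
apply/bounded_linear_predP; split; first exact: linearP.
have /linear_boundedP/pinfty_ex_gt0[k _ dk] :
    bounded_near ('d J u) (nbhs (0 : H)).
  by apply/linear_bounded_continuous; exact: diff_continuous.
by exists k.
Qed.

Definition gradient : dual H := BoundedLinear gradient_subproof.

End gradient.

Definition Ker {R : realType} {V W : normedModType R}
  (T : bounded_linear V W) : set V := [set u | T u = 0].

Definition minimizer {R : realType} {V : Type} (J : V -> R) (K : set V)
  (u : V) := K u /\ forall v, K v -> J u <= J v.

(* Main.v *)
Require Import Defs.
From mathcomp Require Import all_boot all_order all_algebra sesquilinear.
From mathcomp Require Import mathcomp_extra boolp classical_sets functions.
From mathcomp Require Import reals topology normedtype landau derive convex.
From mathcomp Require Import interval_inference sequences ring lra.

Import Order.TTheory GRing.Theory Num.Theory.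
Import numFieldNormedType.Exports.

Local Open Scope classical_set_scope.
Local Open Scope ring_scope.

(** The optimality condition for minimising [J] over the subspace [Ker T] is
    that [gradient J u] vanishes on [Ker T]: it is necessary because [J] has a
    one-sided minimum at [u] along every [v] in [Ker T] and along [- v]
    ([minimizer_diff_eq0]), and sufficient because a convex function lies above
    its tangent planes ([convex_diff_le]).

    What remains is that a functional [g] vanishing on [Ker T] belongs to the
    range of [dual_operator T] ([annihilator_Ker_range]).  Let [w] represent
    [g] in the sense of Riesz, and let [S q] represent [dual_operator T q].
    The lower bound on [dual_operator T] says that [S : M -> H] is bounded
    below, so [w] has an orthogonal projection [S p] on the range of [S].  The
    error [z = w - S p] is orthogonal to every [S q], that is, [T z = 0]; hence
    [g z = 0], where [g z] is the inner product of [w = S p + z] with [z], so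
    [z = 0] and [g] is represented by [S p].

    The Riesz representation and the projection are two instances of one
    existence result, [lax_milgram_pullback]: if [S : V -> H] is bounded below
    and [V] is complete, every bounded functional on [V] has the form
    [q |-> inner (S p) (S q)].  It follows by minimising the energy
    [`|S q| ^+ 2 - 2 * f q].  Riesz is the case where [S] is the identity; the
    projection is the case where [f q = inner w (S q)], and that functional is
    simply [T w].

    Uniqueness of the multiplier is the injectivity of an operator that is
    bounded below. *)

(** * Inner products *)

Lemma innerC (R : realType) (H : hilbertType R) (x y : H) :
  inner x y = inner y x.
Proof. by rewrite hermC /= expr0 mul1r. Qed.

Lemma sqr_normD (R : realType) (H : hilbertType R) (x y : H) :
  `|x + y| ^+ 2 = `|x| ^+ 2 + 2 * inner x y + `|y| ^+ 2.
Proof.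
rewrite !sqr_normE linearDl !linearD /= (innerC _ _ y x); ring.
Qed.

(** The norm already satisfies the triangle inequality; expanding its square
    with [sqr_normD] leaves exactly this bound on the cross term. *)
Lemma ler_inner (R : realType) (H : hilbertType R) (x y : H) :
  inner x y <= `|x| * `|y|.
Proof.
have : `|x + y| ^+ 2 <= (`|x| + `|y|) ^+ 2.
  by rewrite ler_sqr ?nnegrE ?addr_ge0// ler_normD.
rewrite sqr_normD sqrrD; lra.
Qed.

Lemma ler_norm_inner (R : realType) (H : hilbertType R) (x y : H) :
  `|inner x y| <= `|x| * `|y|.
Proof.
rewrite ler_norml ler_inner andbT lerNl.
by rewrite -[X in _ <= X * _]normrN -linearNl ler_inner.
Qed.

(** * Minimisation of a coercive quadratic energy *)

Lemma bounded_linear_continuous (R : realType) (V W : normedModType R)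
  (f : bounded_linear V W) : continuous f.
Proof.
apply/linear_bounded_continuous/linear_boundedP.
exists `|f|; split=> // k fk x; rewrite (le_trans (le_op_norm f x))//.
by rewrite ler_wpM2r// (ltW fk).
Qed.

Lemma quadratic_ge0_linear_eq0 (R : realType) (a b : R) : 0 <= a ->
  (forall t, 0 <= t ^+ 2 * a + 2 * t * b) -> b = 0.
Proof.
move=> a0 ab; apply/eqP; rewrite -sqrf_eq0 eq_le sqr_ge0 andbT.
have a1 : 0 < a + 1 by lra.
(* The minimum of the quadratic is at [- b / a]; the shift by 1 keeps the
   denominator positive when [a = 0], and the value
   there is still negative unless [b = 0]. *)
have := ab (- b / (a + 1)).
have -> : (- b / (a + 1)) ^+ 2 * a + 2 * (- b / (a + 1)) * b =
          - (b ^+ 2 * ((a + 2) / (a + 1) ^+ 2)) by field; lra.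
by rewrite oppr_ge0 pmulr_lle0// divr_gt0 ?exprn_gt0//; lra.
Qed.

Section minimization.
Context (R : realType) (V : completeNormedModType R) (H : hilbertType R).
Variables (S : bounded_linear V H) (f : dual V).

Definition energy (q : V) : R := `|S q| ^+ 2 - 2 * f q.

(** The expansion of the energy along a line: its linear coefficient in [t] is
    the defect in the equation [inner (S p) (S q) = f q]. *)
Lemma energyD (p q : V) (t : R) : energy (p + t *: q) =
  energy p + (t ^+ 2 * `|S q| ^+ 2 + 2 * t * (inner (S p) (S q) - f q)).
Proof.
have fE : f (p + t *: q) = f p + t * f q by rewrite linearD linearZ.
have SE : S (p + t *: q) = S p + t *: S q by rewrite linearD linearZ.
rewrite /energy fE SE sqr_normD linearZ /= normrZ.
rewrite exprMn real_normK ?num_real//.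
ring.
Qed.

(** The linear terms cancel in the parallelogram identity, so two points whose
    energies are both close to the infimum have images close to each other. *)
Lemma energy_parallelogram (p q : V) :
  `|S (p - q)| ^+ 2 =
  2 * energy p + 2 * energy q - 4 * energy (2^-1 *: (p + q)).
Proof.
have -> : 2^-1 *: (p + q) = q + 2^-1 *: (p - q).
  rewrite -[in LHS](subrK q p) -addrA -mulr2n -[q *+ 2]scaler_nat.
  by rewrite scalerDr scalerA mulVf// scale1r addrC.
set d := p - q; have pE : p = q + 1 *: d by rewrite scale1r addrC subrK.
by rewrite [in energy p]pE !energyD; field.
Qed.

Lemma energy_continuous : continuous energy.
Proof.
move=> p; apply: cvgB.
  apply: (@cvgM _ _ _ _ (fun q => `|S q|) (fun q => `|S q|));
    apply: cvg_norm; exact: bounded_linear_continuous.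
apply: cvgMr; exact: bounded_linear_continuous.
Qed.

Variables (c : R).
Hypotheses (c0 : 0 < c) (Sc : forall q, c * `|q| <= `|S q|).

(** The lower bound on [S] controls [f q] by [`|S q|], and the square of
    [`|S q|] dominates a linear term in it: complete the square. *)
Lemma energy_has_inf : has_inf (range energy).
Proof.
split; first by exists (energy 0), 0.
exists (- (`|f| / c) ^+ 2) => _ [q _ <-].
have fq : f q <= `|f| / c * `|S q|.
  rewrite (le_trans (ler_norm _))// (le_trans (le_op_norm f q))//.
  by rewrite -mulrA ler_wpM2l ?op_norm_ge0// mulrC ler_pdivlMr// mulrC.
rewrite /energy; have := sqr_ge0 (`|f| / c - `|S q|); rewrite sqrrB; lra.
Qed.

(** A minimising sequence is Cauchy by the parallelogram identity, and its limit
    is a minimiser because the energy is continuous. *)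
Lemma energy_min : exists p, forall q, energy p <= energy q.
Proof.
set m := inf (range energy).
have mE q : m <= energy q.
  by apply: ge_inf; [case: energy_has_inf|exists q].
have /choice[x xm] n : exists q, energy q < m + n.+1%:R^-1.
  have n0 : 0 < n.+1%:R^-1 :> R by rewrite invr_gt0.
  by have [_ [q _ <-] qm] := inf_adherent n0 energy_has_inf; exists q.
have near_min p q a b : energy p < m + a -> energy q < m + b ->
    (c * `|p - q|) ^+ 2 <= 2 * (a + b).
  move=> pa qb; have := mE (2^-1 *: (p + q)).
  have : (c * `|p - q|) ^+ 2 <= `|S (p - q)| ^+ 2.
    by rewrite ler_sqr ?nnegrE ?mulr_ge0// ltW.
  rewrite energy_parallelogram; lra.
have /cauchy_cvgP xcvg : cauchy (x @ \oo).
  apply/cauchy_exP => e e0.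
  (* [near_min] turns energy excesses below [d] into [c * distance < c * e]. *)
  pose d := (c * e) ^+ 2 / 4.
  have d0 : 0 < d by rewrite divr_gt0// exprn_gt0// mulr_gt0.
  have [N _ Nd] := near_infty_natSinv_lt (PosNum d0).
  exists (x N), N => // n Nn /=; rewrite -ball_normE /ball_ /=.
  rewrite -(ltr_pM2l c0) -ltr_sqr ?nnegrE ?mulr_ge0 ?(ltW c0) ?(ltW e0)//.
  apply: le_lt_trans (near_min _ _ _ _ (xm N) (xm n)) _.
  have : N.+1%:R^-1 < d := Nd N (leqnn N).
  have : n.+1%:R^-1 < d := Nd n Nn.
  rewrite /d; move: (n.+1%:R^-1) (N.+1%:R^-1) => a b; lra.
exists (lim (x @ \oo)) => q; apply: le_trans (mE q).
have Ecvg : energy (x n) @[n --> \oo] --> energy (lim (x @ \oo)).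
  by apply: cvg_comp xcvg _; exact: energy_continuous.
have Mcvg : (m + n.+1%:R^-1) @[n --> \oo] --> m + 0.
  apply: cvgD; [exact: cvg_cst|exact: cvg_harmonic].
rewrite -[m]addr0; apply: ler_cvg_to Ecvg Mcvg _.
by near=> n; exact: ltW.
Unshelve. all: by end_near. Qed.

(** The equation is the vanishing of the first variation of the energy at its
    minimiser. *)
Lemma lax_milgram_pullback : exists p, forall q, inner (S p) (S q) = f q.
Proof.
have [p pmin] := energy_min; exists p => q; apply/eqP; rewrite -subr_eq0.
apply/eqP/(@quadratic_ge0_linear_eq0 _ (`|S q| ^+ 2)); first exact: sqr_ge0.
by move=> t; have := pmin (p + t *: q); rewrite energyD lerDl.
Qed.
End minimization.

(** * Riesz representation and the range of the dual operator *)

Lemma inner_inj (R : realType) (H : hilbertType R) (x y : H) :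
  (forall z, inner x z = inner y z) -> x = y.
Proof.
move=> xy; apply/eqP; rewrite -subr_eq0 -normr_eq0 -sqrf_eq0 sqr_normE.
by rewrite linearBl /= xy subrr.
Qed.

Lemma idfun_bounded_linear (R : realType) (V : normedModType R) :
  (idfun : V -> V) \in bounded_linear_pred.
Proof.
by apply/bounded_linear_predP; split=> //; exists 1 => x; rewrite mul1r.
Qed.

Lemma riesz (R : realType) (H : hilbertType R) (f : dual H) :
  exists w : H, forall v, inner w v = f v.
Proof.
pose I := BoundedLinear (idfun_bounded_linear R H).
by apply: (@lax_milgram_pullback _ _ _ I f 1) => // q; rewrite mul1r.
Qed.

Lemma riesz_norm (R : realType) (H : hilbertType R) (f : dual H) (w : H) :
  (forall v, inner w v = f v) -> `|f| = `|w|.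
Proof.
move=> wf; apply/eqP; rewrite eq_le; apply/andP; split.
  by apply: op_norm_le => // v; rewrite -wf; exact: ler_norm_inner.
have [->|w0] := eqVneq w 0; first by rewrite normr0.
rewrite -(ler_pM2r (_ : 0 < `|w|)) ?normr_gt0// -expr2 sqr_normE wf.
exact: le_trans (ler_norm _) (le_op_norm f w).
Qed.

(** Composing an operator into the dual with the Riesz isometry keeps it linear,
    since representatives are unique, and bounded, since the norm is kept. *)
Lemma riesz_operator (R : realType) (V : normedModType R) (H : hilbertType R)
    (A : bounded_linear V (dual H)) :
  exists S : bounded_linear V H, forall q v, inner (S q) v = A q v.
Proof.
have /choice[s sA] q : exists w, forall v, inner w v = A q v by exact: riesz.
suff sP : s \in bounded_linear_pred by exists (BoundedLinear sP).
apply/bounded_linear_predP; split=> [a p q|].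
  by apply: inner_inj => v; rewrite [RHS]linearPl /= !sA linearP; exact: erefl.
exists `|A| => q; rewrite -(@riesz_norm _ _ (A q))//; exact: (le_op_norm A q).
Qed.

(** The inclusion of the annihilator of [Ker T] in the range of the dual
    operator, which holds because that range is closed.  The proof exhibits the
    preimage by projecting the representative [w] of [g] on the range of [S]. *)
Lemma annihilator_Ker_range (R : realType) (H M : hilbertType R)
  (T : bounded_linear H (dual M)) (C : R) : 0 < C ->
  (forall q : M, C * `|q| <= `|dual_operator T q|) ->
  forall g : dual H, (forall v, Ker T v -> g v = 0) ->
  exists p, dual_operator T p = g.
Proof.
move=> C0 TC g gK.
have [S ST] := riesz_operator _ _ _ (dual_operator T).
have [w wg] := riesz _ _ g.
have SC q : C * `|q| <= `|S q|.
  by rewrite -(riesz_norm _ _ _ _ (ST q)); exact: TC.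
(* The functional [q |-> inner (S q) w] is [T w] itself. *)
have [p pw] := lax_milgram_pullback _ _ _ _ (T w) _ C0 SC.
have TwSp : T (w - S p) = 0.
  apply: bounded_linearP => q.
  rewrite -dual_operatorE -ST linearB /= ST dual_operatorE -pw.
  by rewrite innerC subrr.
exists p; apply: bounded_linearP => v.
(* It remains to see that [w - S p], which lies in [Ker T], is zero. *)
suff -> : g v = inner (S p) v by rewrite ST.
rewrite -wg; congr (inner _ v); apply/eqP; rewrite -subr_eq0 -normr_eq0.
rewrite -sqrf_eq0 sqr_normE [X in X == _]linearBl /= wg gK// ST.
by rewrite dual_operatorE TwSp subrr.
Qed.

(** * First-order optimality *)

(** Only [t > 0] matters below: the minimality and convexity inequalities can be
    divided by [t] without reversing them. *)
Lemma diff_quotient_cvg (R : realType) (V : normedModType R) (J : V -> R^o)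
    (u v : V) : differentiable J u ->
  t^-1 * (J (u + t *: v) - J u) @[t --> 0^'+] --> ('d J u v : R).
Proof.
move=> dJ; rewrite -deriveE //.
have -> : (fun t => t^-1 * (J (u + t *: v) - J u)) =
          (fun h => h^-1 *: ((J \o shift u) (h *: v) - J u)).
  by apply/funext => t /=; rewrite [u + _]addrC.
apply: cvg_dnbhs_at_right; exact: diff_derivable.
Qed.

(** By convexity the difference quotients along the segment from [u] to [v] are
    at most the increment over the whole segment. *)
Lemma convex_diff_le (R : realType) (V : normedModType R) (J : V -> R^o)
    (u v : V) :
  convex_function (setT : set (convex_lmodType V)) J -> differentiable J u ->
  'd J u (v - u) <= J v - J u.
Proof.
move=> cJ dJ; apply: cvgr_to_le (diff_quotient_cvg _ _ _ _ (v - u) dJ) _.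
near=> t.
have t0 : 0 < t by [].
have t1 : t < 1 by near: t; exact: nbhs_right_lt.
rewrite ler_pdivrMl//.
have -> : u + t *: (v - u) = t *: v + (1 - t) *: u.
  by rewrite scalerBl scale1r scalerBr addrCA addrA.
have : J (t *: v + (1 - t) *: u) <= t * J v + (1 - t) * J u :=
  cJ (Itv01 (ltW t0) (ltW t1)) v u (in_setT _) (in_setT _).
lra.
Unshelve. all: by end_near. Qed.

(** A minimum over a subspace makes the differential nonnegative on it, and the
    subspace is stable by opposite. *)
Lemma minimizer_diff_eq0 (R : realType) (V W : normedModType R)
  (T : bounded_linear V W) (J : V -> R^o) (u v : V) : differentiable J u ->
  minimizer J (Ker T) u -> Ker T v -> 'd J u v = 0.
Proof.
move=> dJ [uK umin] vK.
have ge0 z : Ker T z -> 0 <= 'd J u z.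
  move=> zK; apply: cvgr_to_ge (diff_quotient_cvg _ _ _ _ z dJ) _.
  near=> t.
  rewrite mulr_ge0// ?invr_ge0 ?subr_ge0; first exact: ltW.
  by apply: umin; rewrite /Ker /= linearD linearZ /= uK zK scaler0 addr0.
apply/eqP; rewrite eq_le ge0// andbT -oppr_ge0 -linearN ge0//.
by rewrite /Ker /= linearN /= vK oppr0.
Unshelve. all: by end_near. Qed.

Theorem theorem1 (R : realType) (H M : hilbertType R) (J : H -> R^o)
    (J_convex : convex_function (setT : set (convex_lmodType H)) J)
    (J_diff : forall u : H, differentiable J u)
    (T : bounded_linear H (dual M))
    (C : R) (C_gt0 : 0 < C)
    (T_inf_sup : forall q : M, C * `|q| <= `|dual_operator T q|) :
  forall u : H, Ker T u ->
    (minimizer J (Ker T) u <->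
       exists p : M, dual_operator T p = gradient (J_diff u)) /\
    (forall p p' : M, dual_operator T p = gradient (J_diff u) ->
       dual_operator T p' = gradient (J_diff u) -> p = p').
Proof.
move=> u uK; split; last first.
  move=> p p' pu p'u; apply/eqP; rewrite -subr_eq0 -normr_le0.
  rewrite -(pmulr_rle0 _ C_gt0) (le_trans (T_inf_sup _))//.
  have -> : dual_operator T (p - p') = dual_operator T p - dual_operator T p'.
    exact: linearB.
  by rewrite pu p'u subrr normr0.
split=> [umin|[p pu]].
  apply: (annihilator_Ker_range _ _ _ _ _ C_gt0 T_inf_sup) => v vK.
  exact: minimizer_diff_eq0 umin vK.
split=> // v vK; rewrite -subr_ge0.
apply: le_trans (convex_diff_le _ _ _ _ _ J_convex (J_diff u)).
change (0 <= gradient (J_diff u) (v - u)).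
by rewrite -pu dual_operatorE linearB /= uK vK subrr.
Qed.
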